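(* Let $G$ be a finite abelian group of order $n$, let $(\epsilon_h(g),\eta_g,A_g(h,k))$ satisfy the polynomial equations (P1)–(P9), and let $\alpha$ and $\rho$ be the associated $G$-action on, and endomorphism of, the Cuntz algebra $\mathcal{O}_{n+1}$ with canonical generators $\{S\}\cup\{T_g\}_{g\in G}$, determined by $$\alpha_h(S)=S,\quad \alpha_h(T_g)=\epsilon_h(g)T_{g+2h},\quad \rho(S)=\frac1dS+\frac1{\sqrt d}\sum_{g\in G}T_gT_g,$$ $$\alpha_g\rho(T_g)=\eta_gT_gSS^*+\frac{\overline{\eta_g}}{\sqrt d}ST_g^*+\sum_{h,k\in G}A_g(h,k)T_{g+h}T_{g+h+k}T_{g+k}^*.$$ Then $S\in(\mathrm{id},\rho^2)$ and $T_g\in(\alpha_g\rho,\rho^2)$ for every $g\in G$; i.e. $Sx=\rho^2(x)S$ and $T_g\,\alpha_g(\rho(x))=\rho^2(x)T_g$ for all $x\in\mathcal{O}_{n+1}$.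
   Context: $G$ is written additively; $d=\frac{n+\sqrt{n^2+4}}{2}$; $\mathbb T=\{z\in\mathbb C:|z|=1\}$. The Cuntz algebra $\mathcal O_{n+1}$ is the universal unital C$^*$-algebra generated by isometries $S$, $T_g$ ($g\in G$) with mutually orthogonal ranges and $SS^*+\sum_gT_gT_g^*=1$. Under (P1)–(P9) the formulas $\alpha_h(S)=S$, $\alpha_h(T_g)=\epsilon_h(g)T_{g+2h}$, $\rho(S)=\frac1dS+\frac1{\sqrt d}\sum_{g\in G}T_gT_g$, and $\alpha_g\rho(T_g)=\eta_gT_gSS^*+\frac{\overline{\eta_g}}{\sqrt d}ST_g^*+\sum_{h,k\in G}A_g(h,k)T_{g+h}T_{g+h+k}T_{g+k}^*$ (for $g,h\in G$) define a $G$-action $\alpha$ and a unital endomorphism $\rho$ with $\alpha_g\rho=\rho\alpha_{-g}$. Polynomial equations. $\epsilon_h(g)\in\{1,-1\}$, $\eta_g\in\mathbb T$, $A_g(h,k)\in\mathbb C$ satisfy, for all elements of $G$: (P1) $\epsilon_{h+k}(g)=\epsilon_h(g)\epsilon_k(g+2h)$, $\epsilon_h(0)=1$; (P2) $\eta_{g+2h}=\eta_g$, $\eta_g^3=1$; (P3) $\sum_{h}A_g(h,0)=-\overline{\eta_g}/d$; (P4) $\sum_{h}A_g(h-g,k)\overline{A_{g'}(h-g',k)}=\delta_{g,g'}-\frac{\overline{\eta_g}\eta_{g'}}{d}\delta_{k,0}$; (P5) $A_{g+2h}(p,q)=\epsilon_h(g)\epsilon_h(g+p)\epsilon_h(g+q)\epsilon_h(g+p+q)A_g(p,q)$;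 (P6) $A_g(k,h)=\overline{A_g(h,k)}$; (P7) $A_g(h,k)=A_g(-k,h-k)\,\eta_g\,\epsilon_{-k}(g+h)\epsilon_{-k}(g+k)\epsilon_{-k}(g+h+k)=A_g(k-h,-h)\,\overline{\eta_g}\,\epsilon_{-h}(g+h)\epsilon_{-h}(g+k)\epsilon_{-h}(g+h+k)$; (P8) $A_g(h,k)=A_{g+h}(h,k)\eta_g\eta_{g+k}\overline{\eta_{g+h}\eta_{g+h+k}}\epsilon_h(g)\epsilon_h(g+k)=A_{g+k}(h,k)\overline{\eta_g\eta_{g+h}}\eta_{g+k}\eta_{g+h+k}\epsilon_k(g)\epsilon_k(g+h)$; (P9) $\sum_{l}A_g(x+y,l)A_{g-p+x}(-x,l+p)A_{g-q+x+y}(-y,l+q)=A_g(p+x,q+x+y)A_{g-p}(q+y,p+x+y)\,\eta_g\eta_{g+q+x}\eta_{g+p+q+y}\overline{\eta_{g+p}\eta_{g+x+y}\eta_{g+q+x+y}}\,\epsilon_p(g-p+x)\epsilon_{p+x}(g-p+q+y)\epsilon_q(g-q+x+y)\epsilon_{q+y}(g-q+x)-\frac{\delta_{x,0}\delta_{y,0}}{d}\eta_g\eta_{g+p}\eta_{g+q}$. *)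

(* Defs.v *)
From HB Require Import structures.
From mathcomp Require Import all_boot all_order all_algebra.
From mathcomp Require Import complex reals.

Set Implicit Arguments.
Unset Strict Implicit.
Unset Printing Implicit Defensive.

Import Order.TTheory GRing.Theory Num.Theory.

Local Open Scope ring_scope.
Local Open Scope complex_scope.

(* Complex unital C*-algebras, over the ring structure algType R[i].
   MathComp-Analysis' normed modules cannot be used here: Hierarchy-Builder
   has no common substructure of rings and normed Z-modules other than
   numDomainType, and refuses their join.  As an algType has 1 != 0, the zero
   algebra is excluded. *)
HB.mixin Record isCStarAlgebra (R : realType) A of GRing.Algebra R[i] A := {
  star : A -> A ;
  cnorm : A -> R ;
  starK : involutive star ;
  starD : {morph star : x y / x + y} ;
  starZ : forall (a : R[i]) (x : A), star (a *: x) = (a^*)%R *: star x ;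
  starM : forall x y : A, star (x * y) = star y * star x ;
  cnorm_ge0 : forall x : A, 0 <= cnorm x ;
  cnorm_eq0 : forall x : A, cnorm x = 0 -> x = 0 ;
  cnormD : forall x y : A, cnorm (x + y) <= cnorm x + cnorm y ;
  cnormZ : forall (a : R[i]) (x : A),
    (cnorm (a *: x))%:C = `|a| * (cnorm x)%:C ;
  cnormM : forall x y : A, cnorm (x * y) <= cnorm x * cnorm y ;
  cnorm_star : forall x : A, cnorm (star x * x) = cnorm x ^+ 2 ;
  cnorm_complete : forall u : nat -> A,
    (forall e : R, 0 < e -> exists N, forall m n,
       (N <= m)%N -> (N <= n)%N -> cnorm (u m - u n) < e) ->
    exists l : A, forall e : R, 0 < e -> exists N, forall n,
      (N <= n)%N -> cnorm (u n - l) < e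
}.

#[short(type="cstarAlgType")]
HB.structure Definition CStarAlgebra (R : realType) :=
  {A of isCStarAlgebra R A & GRing.Algebra R[i] A}.

Definition unital_star_hom (R : realType) (A B : cstarAlgType R)
    (f : A -> B) : Prop :=
  [/\ linear f, monoid_morphism f & forall x, f (star x) = star (f x)].

(* v \in (sigma, tau) *)
Definition intertwiner (R : realType) (A : cstarAlgType R)
    (sigma tau : A -> A) (v : A) : Prop :=
  forall x, v * sigma x = tau x * v.

Definition isometry (R : realType) (A : cstarAlgType R) (v : A) : Prop :=
  star v * v = 1.

Definition orthogonal_ranges (R : realType) (A : cstarAlgType R)
    (v w : A) : Prop :=
  (v * star v) * (w * star w) = 0.

Definition cuntz_family (R : realType) (G : finType) (A : cstarAlgType R)
    (S : A) (T : G -> A) : Prop :=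
  [/\ isometry S /\ (forall g, isometry (T g)),
      forall g, orthogonal_ranges S (T g),
      forall g h, g != h -> orthogonal_ranges (T g) (T h)
    & S * star S + \sum_(g : G) T g * star (T g) = 1].

(* (A, S, T) is initial among unital C*-algebras equipped with a Cuntz family
   indexed by {S} + G, i.e. it is O_(#|G| + 1) with its canonical generators.
   Uniqueness of f amounts to A being generated by the family as a
   C*-algebra: the map from A to the C*-subalgebra generated by the family,
   followed by the inclusion, has to be the identity. *)
Definition cuntz_algebra (R : realType) (G : finType) (A : cstarAlgType R)
    (S : A) (T : G -> A) : Prop :=
  cuntz_family S T /\
  forall (B : cstarAlgType R) (S' : B) (T' : G -> B), cuntz_family S' T' ->
    exists f : A -> B,
      [/\ unital_star_hom f, f S = S', (forall g, f (T g) = T' g)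
        & forall f' : A -> B, unital_star_hom f' -> f' S = S' ->
            (forall g, f' (T g) = T' g) -> f' =1 f].

(* The inverse of alpha g is alpha (- g), so each alpha g is an
   automorphism. *)
Definition star_action (R : realType) (G : zmodType) (A : cstarAlgType R)
    (alpha : G -> A -> A) : Prop :=
  [/\ forall g, unital_star_hom (alpha g), alpha 0 =1 id
    & forall g h, alpha (g + h) =1 alpha g \o alpha h].

Definition dimd (R : realType) (n : nat) : R :=
  (n%:R + Num.sqrt (n%:R ^+ 2 + 4)) / 2.

Definition delta (R : realType) (G : eqType) (g h : G) : R[i] := (g == h)%:R.

(* Index conventions: eps h g is $\epsilon_h(g)$ and A g h k is $A_g(h,k)$. *)
Record polynomial_equations (R : realType) (G : finZmodType)
    (eps : G -> G -> R[i]) (eta : G -> R[i]) (A : G -> G -> G -> R[i])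
    : Prop := PolynomialEquations {
  eps_sign : forall h g, eps h g = 1 \/ eps h g = -1 ;
  eta_circle : forall g, `|eta g| = 1 ;
  P1 : (forall h k g, eps (h + k) g = eps h g * eps k (g + h *+ 2)) /\
       (forall h, eps h 0 = 1) ;
  P2 : (forall g h, eta (g + h *+ 2) = eta g) /\
       (forall g, eta g ^+ 3 = 1) ;
  P3 : forall g,
    \sum_h A g h 0 = - (eta g)^*%R / (dimd R #|G|)%:C ;
  P4 : forall g g' k,
    \sum_h A g (h - g) k * (A g' (h - g') k)^*%R =
    delta R g g' - (eta g)^*%R * eta g' / (dimd R #|G|)%:C * delta R k 0 ;
  P5 : forall g h p q,
    A (g + h *+ 2) p q =
    eps h g * eps h (g + p) * eps h (g + q) * eps h (g + p + q) * A g p q ;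
  P6 : forall g h k, A g k h = (A g h k)^*%R ;
  P7 : forall g h k,
    A g h k = A g (- k) (h - k) * eta g * eps (- k) (g + h)
              * eps (- k) (g + k) * eps (- k) (g + h + k) /\
    A g h k = A g (k - h) (- h) * (eta g)^*%R * eps (- h) (g + h)
              * eps (- h) (g + k) * eps (- h) (g + h + k) ;
  P8 : forall g h k,
    A g h k = A (g + h) h k * eta g * eta (g + k)
              * (eta (g + h) * eta (g + h + k))^*%R
              * eps h g * eps h (g + k) /\
    A g h k = A (g + k) h k * (eta g * eta (g + h))^*%R
              * eta (g + k) * eta (g + h + k)
              * eps k g * eps k (g + h) ;
  P9 : forall g p q x y,
    \sum_l A g (x + y) l * A (g - p + x) (- x) (l + p)
           * A (g - q + x + y) (- y) (l + q) =
    A g (p + x) (q + x + y) * A (g - p) (q + y) (p + x + y)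
      * eta g * eta (g + q + x) * eta (g + p + q + y)
      * (eta (g + p) * eta (g + x + y) * eta (g + q + x + y))^*%R
      * eps p (g - p + x) * eps (p + x) (g - p + q + y)
      * eps q (g - q + x + y) * eps (q + y) (g - q + x)
    - delta R x 0 * delta R y 0 / (dimd R #|G|)%:C
      * eta g * eta (g + p) * eta (g + q)
}.

Definition alpha_formulas (R : realType) (G : finZmodType)
    (eps : G -> G -> R[i]) (O : cstarAlgType R) (S : O) (T : G -> O)
    (alpha : G -> O -> O) : Prop :=
  forall h, alpha h S = S /\
    forall g, alpha h (T g) = eps h g *: T (g + h *+ 2).

Definition rho_formulas (R : realType) (G : finZmodType)
    (eta : G -> R[i]) (A : G -> G -> G -> R[i])
    (O : cstarAlgType R) (S : O) (T : G -> O)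
    (alpha : G -> O -> O) (rho : O -> O) : Prop :=
  let d := dimd R #|G| in
  rho S = d^-1%:C *: S + (Num.sqrt d)^-1%:C *: \sum_g T g * T g /\
  forall g, alpha g (rho (T g)) =
    eta g *: (T g * S * star S)
    + ((eta g)^*%R / (Num.sqrt d)%:C) *: (S * star (T g))
    + \sum_h \sum_k
        A g h k *: (T (g + h) * T (g + h + k) * star (T (g + k))).

(* Main.v *)
Require Import Defs.
From mathcomp Require Import all_boot all_order all_algebra.
From mathcomp Require Import complex reals ring.

(* The map sigma x = S x S^* + sum_g T_g alpha_g(rho x) T_g^* is a unital
   *-endomorphism of the Cuntz algebra such that sigma(x) S = S x and
   sigma(x) T_g = T_g alpha_g(rho x), so the claim is sigma = rho^2.  As O is
   generated by the Cuntz family, it is enough to compare both maps at S and at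
   each T_m.  Two elements agree as soon as their products with S and with all
   T_g on the right do; moreover rho(S), rho(T_g) is again a Cuntz family, so
   rho^2(T_m) and sigma(T_m) can be multiplied on the right by words
   rho(T_c) T_b and so on.  After these multiplications no adjoint is left, and
   comparing coefficients of words in S and T_g leaves scalar identities: the
   orthogonality relation (P4) in three disguises, the normalisation (P3),
   symmetries of A, and, for rho^2(T_m) rho(T_c) T_b, the cubic relation
   (P9). *)

Set Implicit Arguments.
Unset Strict Implicit.
Unset Printing Implicit Defensive.

Import Order.TTheory GRing.Theory Num.Theory.

Local Open Scope ring_scope.

(** * Deciding equalities of monomials in eps, eta and A *)

(* Equalities of products of values of eps, eta and A at linear forms in given
   group elements are decided by lifting the linear forms to the free abelian
   group on these elements, where translation by doubles acts freely.  There
   the cocycle eps is a coboundary: writing g = r + 2q with coefficients of r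
   in {0, 1}, (P1) gives eps h g = eps q r * eps (q + h) r. *)

(* Coefficients over a list of group elements. *)
Definition lform := seq int.

Fixpoint ladd (u v : lform) : lform :=
  match u, v with
  | [::], _ => v
  | _, [::] => u
  | a :: u', b :: v' => a + b :: ladd u' v'
  end.

Definition lquo (u : lform) : lform := [seq (a %/ 2)%Z | a <- u].
Definition lrem (u : lform) : lform := [seq (a %% 2)%Z | a <- u].
Definition lzero (u : lform) : bool := all (fun a => a == 0) u.

(** Trailing zeros are dropped so that equal linear forms become syntactically equal lists, as
    counting multiplicities requires. *)
Fixpoint ltrim (u : lform) : lform :=
  if u is a :: u' then
    let v := ltrim u' in if (a == 0) && nilp v then [::] else a :: v
  else [::].

Inductive gexp :=
  | GVar of nat | GZero | GAdd of gexp & gexp | GOpp of gexp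
  | GMuln of gexp & nat.

Fixpoint glin (e : gexp) : lform :=
  match e with
  | GVar i => rcons (nseq i 0) 1
  | GZero => [::]
  | GAdd e1 e2 => ladd (glin e1) (glin e2)
  | GOpp e1 => map -%R (glin e1)
  | GMuln e1 n => [seq a *+ n | a <- glin e1]
  end.

Inductive mexp :=
  | MOne | MMul of mexp & mexp | MConj of mexp
  | MEps of gexp & gexp | MEta of gexp | MA of gexp & gexp & gexp.

(* The lists of arguments of the factors eps, eta and A. *)
Record monom := Monom {
  m_eps : seq (lform * lform) ; m_eta : seq lform ;
  m_A : seq (lform * lform * lform) }.

Definition meps (h g : lform) : seq (lform * lform) :=
  let r := ltrim (lrem g) in let q := lquo g in
  [:: (ltrim q, r); (ltrim (ladd q h), r)].

Arguments meps : simpl never.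

(** Conjugation fixes [eps], squares [eta] since its values are cube roots of unity, and swaps the
    last two arguments of [A] by (P6). Subscripts of [eta] and [A] are reduced modulo doubles by
    (P2) and (P5), the latter at the cost of four signs. *)
Fixpoint mnorm (e : mexp) : monom :=
  match e with
  | MOne => Monom [::] [::] [::]
  | MMul e1 e2 =>
      let m1 := mnorm e1 in let m2 := mnorm e2 in
      Monom (m_eps m1 ++ m_eps m2) (m_eta m1 ++ m_eta m2) (m_A m1 ++ m_A m2)
  | MConj e1 =>
      let m1 := mnorm e1 in
      Monom (m_eps m1) (m_eta m1 ++ m_eta m1)
        [seq (x.1.1, x.2, x.1.2) | x <- m_A m1]
  | MEps h g => Monom (meps (glin h) (glin g)) [::] [::]
  | MEta g => Monom [::] [:: ltrim (lrem (glin g))] [::]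
  | MA g h k =>
      let q := lquo (glin g) in let r := lrem (glin g) in
      let h := glin h in let k := glin k in
      Monom (meps q r ++ meps q (ladd r h) ++ meps q (ladd r k)
             ++ meps q (ladd (ladd r h) k))
        [::] [:: (ltrim r, ltrim h, ltrim k)]
  end.

(* eps has values of order 2, hence it is enough to compare multiplicities of
   its arguments modulo 2; those of eta count modulo 3. *)
Definition mcheck (e1 e2 : mexp) : bool :=
  let m1 := mnorm e1 in let m2 := mnorm e2 in
  let s := m_eps m1 ++ m_eps m2 in
  let t := m_eta m1 ++ m_eta m2 ++ m_eta m2 in
  [&& perm_eq (m_A m1) (m_A m2),
      all (fun x => [|| lzero x.1, lzero x.2 | ~~ odd (count_mem x s)]) s
    & all (fun x => 3 %| count_mem x t)%N t].

(** * Soundness of the normal form of monomials *)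

Section Soundness.
Variables (R : realType) (G : finZmodType).
Variables (eps : G -> G -> R[i]) (eta : G -> R[i]) (A : G -> G -> G -> R[i]).
Hypothesis hP : polynomial_equations eps eta A.
Variable vs : seq G.

Fixpoint gsem (e : gexp) : G :=
  match e with
  | GVar i => vs`_i
  | GZero => 0
  | GAdd e1 e2 => gsem e1 + gsem e2
  | GOpp e1 => - gsem e1
  | GMuln e1 n => gsem e1 *+ n
  end.

(** Coefficients beyond the end of [vs] contribute 0, in agreement with the default value of
    variables in [gsem]. *)
Fixpoint lsem_rec (vs : seq G) (u : lform) {struct u} : G :=
  match u, vs with
  | a :: u', v :: vs' => v *~ a + lsem_rec vs' u'
  | _, _ => 0
  end.
Definition lsem := lsem_rec vs.

Fixpoint msem (e : mexp) : R[i] :=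
  match e with
  | MOne => 1
  | MMul e1 e2 => msem e1 * msem e2
  | MConj e1 => (msem e1)^*
  | MEps h g => eps (gsem h) (gsem g)
  | MEta g => eta (gsem g)
  | MA g h k => A (gsem g) (gsem h) (gsem k)
  end.

Definition monom_sem (m : monom) : R[i] :=
  (\prod_(x <- m_eps m) eps (lsem x.1) (lsem x.2)) *
  (\prod_(x <- m_eta m) eta (lsem x)) *
  (\prod_(x <- m_A m) A (lsem x.1.1) (lsem x.1.2) (lsem x.2)).

Lemma lsem_ladd u v : lsem (ladd u v) = lsem u + lsem v.
Proof.
rewrite /lsem; elim: u v vs => [|a u IH] [|b v] [|x xs] //=;
  rewrite ?add0r ?addr0 //.
by rewrite IH mulrzDr addrACA.
Qed.

Lemma lsem_opp u : lsem (map -%R u) = - lsem u.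
Proof.
rewrite /lsem; elim: u vs => [|a u IH] [|x xs] //=; rewrite ?oppr0 //.
by rewrite IH mulrNz opprD.
Qed.

Lemma lsem_muln u n : lsem [seq a *+ n | a <- u] = lsem u *+ n.
Proof.
rewrite /lsem; elim: u vs => [|a u IH] [|x xs] //=; rewrite ?mul0rn //.
rewrite IH mulrnDl; congr (_ + _).
by elim: n {IH} => // n IHn; rewrite !mulrS mulrzDr IHn.
Qed.

Lemma lsem_trim u : lsem (ltrim u) = lsem u.
Proof.
rewrite /lsem; elim: u vs => [|a u IH] xs //=.
case: ifP => [/andP[/eqP-> /nilP E]|_]; case: xs => [|x xs] //=; last first.
  by rewrite IH.
by rewrite -IH E mulr0z add0r; case: (xs).
Qed.

Lemma lsem_zero u : lzero u -> lsem u = 0.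
Proof.
rewrite /lsem; elim: u vs => [|a u IH] [|x xs] //= /andP[/eqP-> /IH->].
by rewrite mulr0z addr0.
Qed.

Lemma lsem_quo_rem u : lsem u = lsem (lrem u) + lsem (lquo u) *+ 2.
Proof.
rewrite /lsem; elim: u vs => [|a u IH] [|x xs] //=; rewrite ?mul0rn ?addr0 //.
rewrite IH mulrnDl addrACA; congr (_ + _).
by rewrite {1}(divz_eq a 2) mulrzDr addrC mulrzA -pmulrn.
Qed.

Lemma lsem_glin e : lsem (glin e) = gsem e.
Proof.
elim: e => [i||e1 IH1 e2 IH2|e1 IH1|e1 IH1 n] //=.
- rewrite /lsem; elim: i vs => [|i IH] [|x xs] //=; rewrite ?mulr1z ?addr0 //.
  by rewrite IH mulr0z add0r.
- by rewrite lsem_ladd IH1 IH2.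
- by rewrite lsem_opp IH1.
- by rewrite lsem_muln IH1.
Qed.

Lemma eps_sqr h g : eps h g ^+ 2 = 1.
Proof. by case: (eps_sign hP h g) => ->; rewrite ?sqrrN expr1n. Qed.

Lemma eps0 g : eps 0 g = 1.
Proof.
have [/(_ 0 0 g) E _] := P1 hP; move: E (eps_sqr 0 g).
by rewrite mul0rn !addr0 -expr2 => <-.
Qed.

Lemma epsr0 h : eps h 0 = 1. Proof. by have [] := P1 hP. Qed.

Lemma eps_conj h g : (eps h g)^* = eps h g.
Proof. by case: (eps_sign hP h g) => ->; rewrite ?rmorphN rmorph1. Qed.

Lemma eta_cube g : eta g ^+ 3 = 1. Proof. by have [] := P2 hP. Qed.

Lemma eta_conj g : (eta g)^* = eta g * eta g.
Proof.
have e1 : eta g * (eta g)^* = 1 by rewrite -normCK (eta_circle hP) expr1n.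
by rewrite -[LHS]mul1r -(eta_cube g) !exprS expr0 mulr1 -!mulrA e1 mulr1.
Qed.

Lemma meps_sem h g :
  \prod_(x <- meps h g) eps (lsem x.1) (lsem x.2) = eps (lsem h) (lsem g).
Proof.
rewrite /meps big_cons big_seq1 /= !lsem_trim lsem_ladd.
have [-> _] := P1 hP.
by rewrite mulrA -expr2 eps_sqr mul1r -lsem_quo_rem.
Qed.

Lemma eta_rem u : eta (lsem (lrem u)) = eta (lsem u).
Proof. by rewrite [in RHS]lsem_quo_rem; have [-> _] := P2 hP. Qed.

Lemma mnorm_sem e : msem e = monom_sem (mnorm e).
Proof.
rewrite /monom_sem.
elim: e => [|e1 IH1 e2 IH2|e IH|h g|g|g h k]; last first.
- rewrite /mnorm /m_eps /m_eta /m_A big_nil big_seq1 !big_cat !meps_sem /=.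
  by rewrite !lsem_trim !lsem_ladd mulr1 -!lsem_glin
    [lsem (glin g)]lsem_quo_rem (P5 hP) !mulrA.
all: rewrite [LHS]/= [mnorm _]/=.
- by rewrite !big_nil big_seq1 mul1r mulr1 lsem_trim eta_rem lsem_glin.
- by rewrite meps_sem !big_nil !mulr1 !lsem_glin.
- rewrite IH !rmorphM !rmorph_prod big_cat big_map /=; congr (_ * _ * _).
  + by apply: eq_bigr => x _; rewrite eps_conj.
  + by rewrite -big_split /=; apply: eq_bigr => x _; rewrite eta_conj.
  + by apply: eq_bigr => x _; rewrite (P6 hP) conjCK.
- rewrite IH1 IH2 !big_cat /=.
  by rewrite mulrACA; congr (_ * _); apply: mulrACA.
- by rewrite !big_nil !mulr1.
Qed.

Lemma mcheck_sound e1 e2 : mcheck e1 e2 -> msem e1 = msem e2.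
Proof.
case/and3P; rewrite !mnorm_sem /monom_sem.
case: (mnorm e1) (mnorm e2) => [s1 t1 A1] [s2 t2 A2] /=.
move=> HA /allP Hs /allP Ht; rewrite (perm_big _ HA) /=; congr (_ * _ * _).
- set p1 := \prod_(x <- s1) _; set p2 := \prod_(x <- s2) _.
  have p2sqr : p2 * p2 = 1.
    by rewrite -big_split big1 //= => x _; rewrite -expr2 eps_sqr.
  (* A product of signs is its own inverse, so it is enough that the joint product is 1; arguments
     of even multiplicity contribute nothing to it. *)
  suff E : p1 * p2 = 1 by rewrite -[LHS]mulr1 -p2sqr mulrA E mul1r.
  rewrite -big_cat -prodr_undup_exp_count big_seq_cond big1 //= => x.
  rewrite mem_undup andbT => /Hs/or3P[/lsem_zero->|/lsem_zero->|].
  + by rewrite eps0 expr1n.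
  + by rewrite epsr0 expr1n.
  + move=> /even_halfK <-; rewrite -mul2n exprM eps_sqr expr1n //.
- set p1 := \prod_(x <- t1) _; set p2 := \prod_(x <- t2) _.
  have p2cube : p2 * p2 * p2 = 1.
    rewrite -!big_split big1 //= => x _.
    by rewrite -(eta_cube (lsem x)) !exprS expr0 mulr1 mulrA.
  (* Here the inverse of [p2] is its square, which is why [mcheck] enters the [eta] arguments of the
     second monomial twice. *)
  suff E : p1 * (p2 * p2) = 1 by rewrite -[LHS]mulr1 -p2cube mulrA E mul1r.
  rewrite -!big_cat -prodr_undup_exp_count big_seq_cond big1 //= => x.
  rewrite mem_undup andbT => /Ht/dvdnP[k ->].
  by rewrite mulnC exprM eta_cube expr1n.
Qed.

End Soundness.

(** * Reflection tactics for monomials and for linear identities in [G] *)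

Ltac phase_index x vs :=
  lazymatch vs with
  | x :: _ => constr:(0%N)
  | _ :: ?vs' => let i := phase_index x vs' in constr:(S i)
  end.

Ltac reify_group vs t :=
  lazymatch t with
  | 0 => constr:(GZero)
  | ?a + ?b =>
      let a' := reify_group vs a in let b' := reify_group vs b in
      constr:(GAdd a' b')
  | - ?a => let a' := reify_group vs a in constr:(GOpp a')
  | ?a *+ ?n => let a' := reify_group vs a in constr:(GMuln a' n)
  | _ => let i := phase_index t vs in constr:(GVar i)
  end.

Ltac reify_monomial eps eta A vs t :=
  lazymatch t with
  | 1 => constr:(MOne)
  | ?a * ?b =>
      let a' := reify_monomial eps eta A vs a in
      let b' := reify_monomial eps eta A vs b in constr:(MMul a' b')
  | Num.conj ?a =>
      let a' := reify_monomial eps eta A vs a in constr:(MConj a')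
  | eps ?h ?g =>
      let h' := reify_group vs h in let g' := reify_group vs g in
      constr:(MEps h' g')
  | eta ?g => let g' := reify_group vs g in constr:(MEta g')
  | A ?g ?h ?k =>
      let g' := reify_group vs g in let h' := reify_group vs h in
      let k' := reify_group vs k in constr:(MA g' h' k')
  end.

Ltac phase hP vs :=
  lazymatch type of hP with
  | polynomial_equations ?eps ?eta ?A =>
    lazymatch goal with
    | |- ?l = ?r =>
      let l' := reify_monomial eps eta A vs l in
      let r' := reify_monomial eps eta A vs r in
      apply: (@mcheck_sound _ _ eps eta A hP vs l' r'); vm_compute; reflexivity
    end
  end.

(** Both sides are compared in the free abelian group on [vs], so exactly the formal consequences of
    the abelian group laws are decided. *)
Ltac group_eq vs :=
  lazymatch goal with
  | |- ?l = ?r =>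
    let l' := reify_group vs l in let r' := reify_group vs r in
    change (gsem vs l' = gsem vs r');
    rewrite -!lsem_glin -[LHS]lsem_trim -[RHS]lsem_trim;
    congr (lsem vs _); vm_compute; reflexivity
  end.

(** * The polynomial equations in terms of the coefficients of rho *)

Section Identities.
Variables (R : realType) (G : finZmodType).
Variables (eps : G -> G -> R[i]) (eta : G -> R[i]) (A : G -> G -> G -> R[i]).
Hypothesis hP : polynomial_equations eps eta A.

(** The sign with which [alpha (- m)] sends [T m] to [T (- m)]. *)
Definition sgnr m := eps (- m) m.
(* The coefficient of T a * T (a + c + m) * star (T c) in rho (T m). *)
Definition Acoef m a c :=
  A m (a + m) (c + m) * eps m a * eps m c * eps m (a + c + m).
Local Notation d := (dimd R #|G|)%:C%C.
Local Notation E := sgnr.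
Local Notation B := Acoef.

(** (P8) moves the subscript [g] to [a] up to a double, which (P5) removes; what is left is the sum
    of (P3) at [a]. *)
Lemma sum_Acoef_opp a : \sum_g eta g * E g * B g a (- g) = - d^-1.
Proof.
transitivity (eta a * \sum_g A a (a + g) 0).
  rewrite big_distrr; apply: eq_bigr => g _ /=.
  by rewrite /E /B (P8 hP g _ _).1; phase hP [:: a; g].
have := P3 hP a; rewrite (reindex_inj (addrI a)) /= => ->.
by rewrite mulrA mulrN -normCK (eta_circle hP) expr1n mulN1r.
Qed.

(** Complex conjugate of the preceding sum: by (P6), conjugation swaps the last two arguments of
    [Acoef]. *)
Lemma sum_Acoef_opp_l c : \sum_g (eta g)^* * E g * B g (- g) c = - d^-1.
Proof.
have := sum_Acoef_opp c; move/(congr1 Num.conj).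
rewrite rmorph_sum rmorphN fmorphV /= conj_Creal ?complex_real // => <-.
apply: eq_bigr => g _; rewrite /E /B; phase hP [:: c; g].
Qed.

Lemma sum_Acoef2 b k m :
  \sum_g B g b (k - g) * B g (k - g) m = (b == m)%:R - (k == 0)%:R / d.
Proof.
(* [C] collects the phases produced by (P5), (P7) and (P8): as it does not
   depend on the summation index, it can be taken out of the sum. *)
pose C := eps (- b) b * eps (- b) (b + k) * eps (- m) m * eps (- m) (m + k)
  * (eta b * eta (b + k))^* * eta m * eta (m + k).
transitivity (C * \sum_g A (- b) (g - - b) k * (A (- m) (g - - m) k)^*).
  rewrite big_distrr; apply: eq_bigr => g _ /=.
  rewrite /C /B (P8 hP g (b + g) _).1 (P8 hP g _ (m + g)).2.
  by phase hP [:: b; k; m; g].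
rewrite (P4 hP) /delta eqr_opp mulrBr; congr (_ - _).
  case: eqP => [bm|_]; last by rewrite mulr0.
  by rewrite mulr1 /C -bm -[RHS]/(1 : R[i]); phase hP [:: b; k].
case: eqP => [k0|_]; last by rewrite !mulr0 mul0r.
rewrite mulr1 mul1r mulrA -[RHS]mul1r; congr (_ * _).
by rewrite /C k0; phase hP [:: b; m].
Qed.

(** An instance of the rotation of order three in (P7), at the subscript [- m]. It matches the cubic
    words of [rho (rho (T m)) * rho S] with those of [sigma (T m) * rho S]. *)
Lemma Acoef_cycle m a g :
  eps (- g) m * B (m - g *+ 2) a g = eta m * E m * B (- m) g (a + m - g).
Proof.
rewrite /E /B (P7 hP (- m) _ _).2; phase hP [:: m; a; g].
Qed.

Lemma sum_Acoef_row m : \sum_a B m a (- m) = - ((eta m)^* * E m / d).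
Proof.
transitivity (E m * \sum_a A m (m + a) 0).
  rewrite big_distrr; apply: eq_bigr => a _ /=.
  by rewrite /E /B; phase hP [:: m; a].
have := P3 hP m; rewrite (reindex_inj (addrI m)) /= => ->.
by rewrite mulNr mulrN mulrA [E m * _]mulrC.
Qed.

(** (P4) at the subscripts [c] and [- g], to which (P7) and (P8) carry [m] and [a] up to doubles.
    The phase [C] does not depend on [a], and the two terms of (P4) become the two terms on the
    right. *)
Lemma sum_Acoef_lam m c g :
  \sum_a B m a c * B a g (- (a + c + m)) * (eta (a + c + m) * E (a + c + m))
  = (g == - c)%:R
      * (eps c m * (eta c * E c) * (eta (m + c *+ 2) * E (m + c *+ 2)))
    - (c == - m)%:R * ((eta m)^* * E m / d).
Proof.
pose C := eps c m * eps (- c - m) (c + g + m) * eps (- g) g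
  * eps (- g) (c + g + m) * (eta m)^* * eta c * (eta (c + g + m))^*.
transitivity (C * \sum_a A c (a + m + c - c) (c + m)
                    * (A (- g) (a + m + c - - g) (c + m))^*).
  rewrite big_distrr; apply: eq_bigr => a _ /=.
  rewrite /C /E /B (P8 hP m _ _).2 (P7 hP a _ _).1 (P8 hP a _ _).2.
  by rewrite (P8 hP (a + _) _ _).1; phase hP [:: m; c; g; a].
have := P4 hP c (- g) (c + m).
rewrite (reindex_inj (addIr c)) (reindex_inj (addIr m)) /= => ->.
rewrite /delta mulrBr eq_sym eqr_oppLR addr_eq0; congr (_ - _).
  case: eqP => [E0|_]; last by rewrite mulr0 mul0r.
  by rewrite mulr1 mul1r /C /E E0; phase hP [:: m; c].
case: eqP => [c_m|_]; last by rewrite mulr0 mul0r mulr0.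
rewrite mulr1 mul1r !mulrA; congr (_ / _).
by rewrite /C /E c_m; phase hP [:: m; g].
Qed.

Lemma Acoef_transpose m c g b : g = b + m + c ->
  eps (- g) m * B c g b * ((eta m)^* * E (m - g *+ 2))
  = B m (- g) c * (eta g * E (- g)) * ((eta b)^* * E b).
Proof.
move=> ->; rewrite /E /B (P7 hP c _ _).1 (P8 hP c _ _).2.
by phase hP [:: m; c; b].
Qed.

(** (P4) again, now at the subscripts [c] and [- b]; here (P8) alone moves the subscripts. *)
Lemma sum_Acoef_kap m c b :
  \sum_a B m a c * ((eta a)^* * E a) * B (a + c + m) (- a) b
  = (b == - c)%:R * ((eta c)^* * E c) - (c == - m)%:R * ((eta m)^* * E m / d).
Proof.
pose C := eps c m * eps (- b) b * eps (- b) (b + c + m) * (eta m)^* * eta c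
  * eta b * eta (b + c + m).
transitivity (C * \sum_a A c (a + m + c - c) (c + m)
                    * (A (- b) (a + m + c - - b) (c + m))^*).
  rewrite big_distrr; apply: eq_bigr => a _ /=.
  rewrite /C /E /B (P8 hP m _ _).2 (P8 hP (a + c + m) _ _).2.
  by phase hP [:: m; c; b; a].
have := P4 hP c (- b) (c + m).
rewrite (reindex_inj (addIr c)) (reindex_inj (addIr m)) /= => ->.
rewrite /delta mulrBr eq_sym eqr_oppLR addr_eq0; congr (_ - _).
  case: eqP => [E0|_]; last by rewrite mulr0 mul0r.
  by rewrite mulr1 mul1r /C /E E0; phase hP [:: m; c].
case: eqP => [c_m|_]; last by rewrite mulr0 mul0r mulr0.
rewrite mulr1 mul1r !mulrA; congr (_ / _).
by rewrite /C /E c_m; phase hP [:: m; b].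
Qed.

Lemma sum_Acoef3 m c b g u :
  \sum_a B m a c * B a g (u - g - a) * B (a + c + m) (u - g - a) b
  = eps (- g) m * B c g b * B (m - g *+ 2) u (g + b + c)
    - (c == - m)%:R * (u == g)%:R * ((eta m)^* * E m / d).
Proof.
(* Up to the factor C, moving subscripts by (P8)
   and permuting arguments by (P7) turns the sum into that of (P9) at
   (c, p, q, x, y) with l = a - c. *)
pose z := b + c + g + m + u.
pose C := eps (- m) m * eps (u - g *+ 2) g * eps (- g) u * eps (- b - c - m) b
  * eps (- g) z * eps (- b - c - g - m) z * (eta m * eta c * eta u)^*
  * eta b * eta z.
pose p := g *+ 2 - u + c; pose q := b + c *+ 2 + m.
pose x := u - g; pose y := - (u - g + c + m).
have := P9 hP c p q x y; rewrite (reindex_inj (addrI (- c))).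
set S9 := \sum_a _; move=> H9.
transitivity (C * S9).
  rewrite big_distrr; apply: eq_bigr => a _ /=.
  rewrite /C /p /q /x /y /z /E /B.
  rewrite (P7 hP m _ _).1 (P8 hP m _ _).1.
  rewrite (P8 hP a _ _).1 (P7 hP (a + _) _ _).1.
  rewrite (P8 hP (a + c + m) _ _).2.
  by phase hP [:: m; c; b; g; u; a].
rewrite H9 mulrBr; congr (_ - _).
  rewrite /C /p /q /x /y /z /E /B (P7 hP (m - _) _ _).2 (P8 hP (m - _) _ _).2.
  by phase hP [:: m; c; b; g; u].
(* The correction term of (P9) lives at [x = y = 0], that is, at [u = g] and [c = - m]. *)
rewrite /delta /x subr_eq0 oppr_eq0.
case: (u =P g) => [Eu|_]; last by rewrite !(mul0r, mulr0).
rewrite /y Eu subrr add0r addr_eq0.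
case: eqP => [Ec|_]; last by rewrite !(mul0r, mulr0).
rewrite !mul1r -!mulrA [d^-1 * _]mulrC !mulrA; congr (_ / _).
rewrite /C /p /q /z Eu Ec /E.
by phase hP [:: m; b; g].
Qed.

End Identities.

(** * Cuntz families and their homomorphisms *)

Section UnitalStarHom.
Variables (R : realType) (A B : cstarAlgType R) (f : A -> B).
Hypothesis hf : unital_star_hom f.

Lemma homD x y : f (x + y) = f x + f y.
Proof. by case: hf => l _ _; have := l 1 x y; rewrite !scale1r. Qed.

Lemma hom0 : f 0 = 0.
Proof. by apply: (addrI (f 0)); rewrite -homD !addr0. Qed.

Lemma homZ a x : f (a *: x) = a *: f x.
Proof. by case: hf => l _ _; have := l a x 0; rewrite hom0 !addr0. Qed.

Lemma homM x y : f (x * y) = f x * f y.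
Proof. by case: hf => _ [_ ->]. Qed.

Lemma hom1 : f 1 = 1. Proof. by case: hf => _ [-> _]. Qed.

Lemma hom_star x : f (star x) = star (f x). Proof. by case: hf. Qed.

Lemma hom_sum (I : finType) (P : pred I) (F : I -> A) :
  f (\sum_(i | P i) F i) = \sum_(i | P i) f (F i).
Proof. exact: (big_morph f homD hom0). Qed.

End UnitalStarHom.

Section Star.
Variables (R : realType) (A : cstarAlgType R).

Lemma star0 : star (0 : A) = 0.
Proof. by rewrite -[0 in LHS](scale0r 0) starZ rmorph0 scale0r. Qed.

Lemma star_sum (I : finType) (F : I -> A) :
  star (\sum_i F i) = \sum_i star (F i).
Proof. exact: (big_morph _ (@starD _ _) star0). Qed.

End Star.

Section CuntzFamily.
Variables (R : realType) (G : finType) (O : cstarAlgType R).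
Variables (S : O) (T : G -> O).
Hypothesis hST : cuntz_family S T.

Lemma star_mul_orthogonal (v w : O) :
  Defs.isometry v -> Defs.isometry w -> orthogonal_ranges v w -> star v * w = 0.
Proof.
rewrite /Defs.isometry /orthogonal_ranges => hv hw hvw.
transitivity (star v * (v * star v * (w * star w)) * w).
  by rewrite !mulrA hv mul1r -!mulrA hw mulr1.
by rewrite hvw mulr0 mul0r.
Qed.

Lemma cuntz_SS : star S * S = 1. Proof. by case: hST => [[]]. Qed.

Lemma cuntz_TT g h : star (T g) * T h = (g == h)%:R.
Proof.
case: hST => [[_ iT]] _ oT _; case: eqVneq => [->|gh]; first exact: iT.
exact/star_mul_orthogonal/oT.
Qed.

Lemma cuntz_ST g : star S * T g = 0.
Proof. by case: hST => [[iS iT]] oS _ _; apply: star_mul_orthogonal. Qed.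

Lemma cuntz_TS g : star (T g) * S = 0.
Proof. by rewrite -[LHS]starK starM starK cuntz_ST star0. Qed.

Lemma cuntz_sum : S * star S + \sum_g T g * star (T g) = 1.
Proof. by case: hST. Qed.

(** The range projections sum to 1, so an element is recovered from its products with the generators
    on the right. *)
Lemma cuntz_ext (x y : O) :
  x * S = y * S -> (forall g, x * T g = y * T g) -> x = y.
Proof.
move=> eS eT; rewrite -[x]mulr1 -[y]mulr1 -cuntz_sum !mulrDr !mulrA eS.
by rewrite !mulr_sumr; congr (_ + _); apply: eq_bigr => g _; rewrite !mulrA eT.
Qed.

Lemma cuntz_family_hom (B : cstarAlgType R) (f : O -> B) :
  unital_star_hom f -> cuntz_family (f S) (f \o T).
Proof.
move=> hf; case: hST => [[iS iT]] oS oT eST.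
rewrite /cuntz_family /Defs.isometry /orthogonal_ranges /=.
split; first (split=> [|g]); first 1 last.
all: try by rewrite -(hom_star hf) -(homM hf) (iS, iT) (hom1 hf).
- by move=> g; rewrite -!(hom_star hf) -!(homM hf) oS (hom0 hf).
- by move=> g h gh; rewrite -!(hom_star hf) -!(homM hf) oT ?(hom0 hf).
rewrite -(hom1 hf) -eST (homD hf) (hom_sum hf) (homM hf) (hom_star hf).
by congr (_ + _); apply: eq_bigr => g _; rewrite (homM hf) (hom_star hf).
Qed.

End CuntzFamily.

(** The images of the generators under [f2] form a Cuntz family, and both maps equal the unique
    homomorphism to it. *)
Lemma cuntz_hom_ext (R : realType) (G : finType) (O B : cstarAlgType R)
    (S : O) (T : G -> O) (f1 f2 : O -> B) :
  cuntz_algebra S T -> unital_star_hom f1 -> unital_star_hom f2 ->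
  f1 S = f2 S -> (forall g, f1 (T g) = f2 (T g)) -> f1 =1 f2.
Proof.
move=> [hST univ] h1 h2 eS eT x.
have [f [_ _ _ uf]] := univ _ _ _ (cuntz_family_hom hST h2).
by rewrite (uf f1 h1 eS eT x) -(uf f2 h2 erefl (fun=> erefl) x).
Qed.

(** * Direct sums of endomorphisms along a Cuntz family *)

Section CuntzSum.
Variables (R : realType) (G : finType) (O : cstarAlgType R).
Variables (S : O) (T : G -> O) (f0 : O -> O) (f : G -> O -> O).
Hypothesis hST : cuntz_family S T.

(** The direct sum of [f0] and all [f g], in which [S] and [T g] are the isometries embedding the
    summands. *)
Definition cuntz_sum_hom x :=
  S * f0 x * star S + \sum_g T g * f g x * star (T g).

Lemma cuntz_sum_hom_S x : cuntz_sum_hom x * S = S * f0 x.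
Proof.
rewrite /cuntz_sum_hom mulrDl -mulrA (cuntz_SS hST) mulr1 mulr_suml.
by rewrite big1 ?addr0 // => g _; rewrite -mulrA (cuntz_TS hST) mulr0.
Qed.

Lemma cuntz_sum_hom_T x g : cuntz_sum_hom x * T g = T g * f g x.
Proof.
rewrite /cuntz_sum_hom mulrDl -mulrA (cuntz_ST hST) mulr0 add0r mulr_suml.
rewrite (bigD1 g) //= -mulrA (cuntz_TT hST) eqxx mulr1 big1 ?addr0 // => h hg.
by rewrite -mulrA (cuntz_TT hST) (negbTE hg) mulr0.
Qed.

(** After multiplication by [S] or [T g] on the right, linearity and multiplicativity reduce to
    those of the summands. *)
Lemma cuntz_sum_hom_star_hom :
  unital_star_hom f0 -> (forall g, unital_star_hom (f g)) ->
  unital_star_hom cuntz_sum_hom.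
Proof.
move=> h0 h; split.
- move=> a x y; apply: (cuntz_ext hST) => [|g].
    rewrite cuntz_sum_hom_S [RHS]mulrDl -scalerAl !cuntz_sum_hom_S.
    by rewrite (homD h0) (homZ h0) mulrDr scalerAr.
  rewrite cuntz_sum_hom_T [RHS]mulrDl -scalerAl !cuntz_sum_hom_T.
  by rewrite (homD (h g)) (homZ (h g)) mulrDr scalerAr.
- split=> [|x y]; apply: (cuntz_ext hST) => [|g].
  + by rewrite cuntz_sum_hom_S (hom1 h0) mulr1 mul1r.
  + by rewrite cuntz_sum_hom_T (hom1 (h g)) mulr1 mul1r.
  + by rewrite -mulrA !cuntz_sum_hom_S (homM h0) !mulrA cuntz_sum_hom_S.
  + by rewrite -mulrA !cuntz_sum_hom_T (homM (h g)) !mulrA cuntz_sum_hom_T.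
- move=> x; rewrite /cuntz_sum_hom starD star_sum !starM starK (hom_star h0).
  rewrite mulrA; congr (_ + _); apply: eq_bigr => g _.
  by rewrite !starM starK (hom_star (h g)) mulrA.
Qed.

End CuntzSum.

(** * The quadratic equation of [d] *)

Section FormalDimension.
Variables (R : realType) (n : nat).
Local Notation d := (dimd R n).

Lemma dimd_gt0 : 0 < d.
Proof.
rewrite /dimd divr_gt0 // ltr_wpDl ?ler0n // sqrtr_gt0.
by rewrite ltr_wpDl // exprn_ge0.
Qed.

Lemma dimd_sqr : d ^+ 2 = n%:R * d + 1.
Proof.
rewrite /dimd; set r := Num.sqrt _.
have r2 : r ^+ 2 = n%:R ^+ 2 + 4.
  by rewrite sqr_sqrtr // addr_ge0 // exprn_ge0.
apply/eqP; rewrite -subr_eq0.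
have -> : ((n%:R + r) / 2) ^+ 2 - (n%:R * ((n%:R + r) / 2) + 1)
    = (r ^+ 2 - (n%:R ^+ 2 + 4)) / 4 by field.
by rewrite r2 subrr mul0r.
Qed.

Definition sqrt_dimd : R[i] := (Num.sqrt d)%:C%C.

Lemma dimdC_neq0 : d%:C%C != 0.
Proof. by rewrite (inj_eq (@complexI R)) gt_eqF ?dimd_gt0. Qed.

Lemma sqrt_dimd_sqr : sqrt_dimd * sqrt_dimd = d%:C%C.
Proof. by rewrite -rmorphM -expr2 sqr_sqrtr // ltW ?dimd_gt0. Qed.

Lemma sqrt_dimdV2 : sqrt_dimd^-1 * sqrt_dimd^-1 = d%:C%C^-1.
Proof. by rewrite -invfM sqrt_dimd_sqr. Qed.

(** The quadratic equation divided by the square of [d]; the left side is the coefficient of [S * S]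
    in [rho (rho S) * S]. *)
Lemma dimd_partition : d%:C%C^-1 * d%:C%C^-1 + n%:R / d%:C%C = 1.
Proof.
have e : d%:C%C * d%:C%C = n%:R * d%:C%C + 1.
  by rewrite -rmorphM -expr2 dimd_sqr rmorphD rmorphM rmorph1 rmorph_nat.
apply: (mulIf dimdC_neq0); apply: (mulIf dimdC_neq0).
rewrite mul1r e !mulrDl divfK ?dimdC_neq0 // mulfVK ?dimdC_neq0 //.
by rewrite mulVf ?dimdC_neq0 // addrC.
Qed.

End FormalDimension.

(** * The square of rho *)

Lemma sum_indic_scale (K : pzRingType) (V : lmodType K) (I : finType) (x : I)
    (c : I -> K) (F : I -> V) :
  \sum_i ((i == x)%:R * c i) *: F i = c x *: F x.
Proof.
rewrite (bigD1 x) //= eqxx mul1r big1 ?addr0 // => i /negPf->.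
by rewrite mul0r scale0r.
Qed.

Section Endomorphism.
Variables (R : realType) (G : finZmodType).
Variables (eps : G -> G -> R[i]) (eta : G -> R[i]) (A : G -> G -> G -> R[i]).
Hypothesis hP : polynomial_equations eps eta A.
Variables (O : cstarAlgType R) (S : O) (T : G -> O).
Hypothesis hST : cuntz_family S T.
Variable alpha : G -> O -> O.
Hypothesis halpha : star_action alpha.
Hypothesis halphaE : alpha_formulas eps S T alpha.
Variable rho : O -> O.
Hypothesis hrho : unital_star_hom rho.
Hypothesis hrhoE : rho_formulas eta A S T alpha rho.

Local Notation d := (dimd R #|G|)%:C%C.
Local Notation s := (sqrt_dimd R #|G|).
Local Notation E := (sgnr eps).
Local Notation B := (Acoef eps A).

(** [lam m] is the coefficient of [T (- m) * S] in [rho (T m) * S], and [kap m] that of [S] in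
    [rho (T m) * T (- m)]. *)
Definition lam m := eta m * E m.
Definition kap m := (eta m)^* * E m / s.

Let hal g : unital_star_hom (alpha g). Proof. by case: halpha. Qed.

Lemma alpha_S g : alpha g S = S. Proof. by case: (halphaE g). Qed.

Lemma alpha_T h g : alpha h (T g) = eps h g *: T (g + h *+ 2).
Proof. by case: (halphaE h). Qed.

Lemma alphaD g h x : alpha (g + h) x = alpha g (alpha h x).
Proof. by case: halpha => _ _ ->. Qed.

(** * Products of images under [rho] with generators *)

Lemma rho_S : rho S = d^-1 *: S + s^-1 *: \sum_g T g * T g.
Proof. by case: hrhoE => -> _; rewrite !fmorphV. Qed.

Lemma alpha_rho_S g : alpha g (rho S) = rho S.
Proof.
rewrite rho_S (homD (hal g)) !(homZ (hal g)) alpha_S (hom_sum (hal g)).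
congr (_ + _ *: _); rewrite [RHS](reindex_inj (addIr (g *+ 2))) /=.
apply: eq_bigr => h _; rewrite (homM (hal g)) alpha_T -scalerAl -scalerAr.
by rewrite scalerA -expr2 (eps_sqr hP) scale1r.
Qed.

Lemma rho_S_mul_S : rho S * S = d^-1 *: (S * S) + s^-1 *: \sum_g T g * T g * S.
Proof. by rewrite rho_S mulrDl -!scalerAl mulr_suml. Qed.

Lemma rho_S_mul_T m :
  rho S * T m = d^-1 *: (S * T m) + s^-1 *: \sum_g T g * T g * T m.
Proof. by rewrite rho_S mulrDl -!scalerAl mulr_suml. Qed.

Lemma alpha_rho_T_self m : alpha m (rho (T m)) =
  eta m *: (T m * S * star S) + ((eta m)^* / s) *: (S * star (T m))
  + \sum_h \sum_k A m h k *: (T (m + h) * T (m + h + k) * star (T (m + k))).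
Proof. by case: hrhoE. Qed.

Lemma alpha_rho_T_self_S m : alpha m (rho (T m)) * S = eta m *: (T m * S).
Proof.
rewrite alpha_rho_T_self !mulrDl -!scalerAl -!mulrA.
rewrite (cuntz_SS hST) mulr1 (cuntz_TS hST) mulr0 scaler0 addr0.
rewrite mulr_suml big1 ?addr0 // => h _; rewrite mulr_suml big1 // => k _.
by rewrite -scalerAl -!mulrA (cuntz_TS hST) !mulr0 scaler0.
Qed.

Lemma alpha_rho_T_self_T m c : alpha m (rho (T m)) * T (m + c) =
  ((c == 0)%:R * ((eta m)^* / s)) *: S
  + \sum_h A m h c *: (T (m + h) * T (m + h + c)).
Proof.
rewrite alpha_rho_T_self !mulrDl -!scalerAl -!mulrA.
rewrite (cuntz_ST hST) !mulr0 scaler0 add0r (cuntz_TT hST).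
have -> : (m == m + c) = (c == 0).
  by rewrite -{1}[m]addr0 (inj_eq (addrI m)) eq_sym.
congr (_ + _).
  by case: eqP => _; rewrite ?mulr1 ?mulr0 ?mul1r ?mul0r ?scale0r ?scaler0.
rewrite mulr_suml; apply: eq_bigr => h _; rewrite mulr_suml (bigD1 c) //=.
rewrite -scalerAl -!mulrA (cuntz_TT hST) eqxx mulr1 big1 ?addr0 // => k kc.
rewrite -scalerAl -!mulrA (cuntz_TT hST) (inj_eq (addrI m)) (negPf kc).
by rewrite !mulr0 scaler0.
Qed.

(** Since [alpha g] is [alpha (g - m)] after [alpha m], the given formula for [alpha m (rho (T m))]
    determines all other translates. *)
Lemma alpha_rho_T_S g m : alpha g (rho (T m)) * S =
  (eps (- g) m * lam (m - g *+ 2)) *: (T (g *+ 2 - m) * S).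
Proof.
rewrite -[g](subrK m) alphaD -{1}(alpha_S (g - m)) -(homM (hal _)).
rewrite alpha_rho_T_self_S (homZ (hal _)) (homM (hal _)) alpha_S alpha_T.
rewrite -scalerAl scalerA subrK; congr (_ *: (T _ * S)).
  by rewrite /lam /E; phase hP [:: m; g].
by group_eq [:: m; g].
Qed.

Lemma alpha_rho_T_T g m c : alpha g (rho (T m)) * T c =
  eps (- g) m *: (((c == g *+ 2 - m)%:R * kap (m - g *+ 2)) *: S
    + \sum_a B (m - g *+ 2) a c *: (T a * T (a + c + m - g *+ 2))).
Proof.
(* With these choices [alpha k] sends [T (m + c')] to [T c] up to sign, so the product can be
   computed before [alpha k] is applied. *)
pose k := g - m; pose c' := c - k *+ 2 - m.
have eT : T c = eps k (m + c') *: alpha k (T (m + c')).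
  rewrite alpha_T scalerA -expr2 (eps_sqr hP) scale1r /c' /k; congr T.
  by group_eq [:: c; g; m].
rewrite eT -scalerAr -[g in alpha g](subrK m) alphaD -(homM (hal _)).
rewrite alpha_rho_T_self_T (homD (hal _)) (homZ (hal _)) alpha_S.
rewrite (hom_sum (hal _)) !scalerDr !scalerA.
have ec : (c' == 0) = (c == g *+ 2 - m).
  rewrite -[RHS]subr_eq0 /c' /k; congr (_ == 0).
  by group_eq [:: c; g; m].
rewrite ec; congr (_ + _).
  case: eqP => [cgm|_]; last by rewrite !mul0r !mulr0.
  rewrite !mul1r /kap !mulrA /c' /k cgm /E; congr ((_ / _) *: _).
  by phase hP [:: g; m].
(* The shift makes the first letter equal to [T a] after [alpha k] has been applied. *)
rewrite !scaler_sumr (reindex_inj (addrI (m - g *+ 2))) /=.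
apply: eq_bigr => a _; rewrite (homZ (hal _)) (homM (hal _)) !alpha_T.
rewrite -scalerAl -scalerAr !scalerA /c' /k; congr (_ *: (T _ * T _)).
- by rewrite /B; phase hP [:: g; m; c; a].
- by group_eq [:: g; m; c; a].
- by group_eq [:: g; m; c; a].
Qed.

Lemma rho_T_S m : rho (T m) * S = lam m *: (T (- m) * S).
Proof.
have := alpha_rho_T_S 0 m; case: halpha => _ -> _ ->.
by rewrite mul0rn oppr0 (eps0 hP) mul1r addr0 sub0r.
Qed.

Lemma rho_T_T m c : rho (T m) * T c =
  ((c == - m)%:R * kap m) *: S + \sum_a B m a c *: (T a * T (a + c + m)).
Proof.
have := alpha_rho_T_T 0 m c; case: halpha => _ -> _ ->.
rewrite mul0rn oppr0 (eps0 hP) scale1r sub0r addr0; congr (_ + _).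
by apply: eq_bigr => a _; rewrite addr0.
Qed.

(** The relation between [alpha g] after [rho] and [rho] after [alpha (- g)], evaluated at [T m]. *)
Lemma alpha_rho_T g m :
  alpha g (rho (T m)) = eps (- g) m *: rho (T (m - g *+ 2)).
Proof.
apply: (cuntz_ext hST) => [|c]; rewrite -scalerAl.
  by rewrite alpha_rho_T_S rho_T_S scalerA opprB.
rewrite alpha_rho_T_T rho_T_T opprB; congr (_ *: (_ + _)).
by apply: eq_bigr => a _; rewrite addrA.
Qed.

Lemma lam_kap g : lam g * kap g = s^-1.
Proof.
rewrite /lam /kap mulrA -[RHS]mul1r; congr (_ / _).
by rewrite /E; phase hP [:: g].
Qed.

Lemma rho_T_rho_T_S a e : rho (T a) * rho (T e) * S =
  ((a == e)%:R / s) *: (S * S)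
  + \sum_g (B a g (- e) * lam e) *: (T g * T (g - e + a) * S).
Proof.
rewrite -[LHS]mulrA rho_T_S -[LHS]scalerAr [X in _ *: X = _]mulrA rho_T_T.
rewrite [X in _ *: X = _]mulrDl scalerDr -scalerAl [X in X + _ = _]scalerA.
rewrite eqr_opp [e == a]eq_sym; congr (_ *: _ + _).
  by case: eqP => [->|_]; rewrite ?mul0r ?mulr0 // !mul1r lam_kap.
rewrite mulr_suml scaler_sumr; apply: eq_bigr => g _.
by rewrite -scalerAl scalerA; congr (_ *: _); rewrite [LHS]mulrC.
Qed.

Lemma rho_T_rho_T_T a e b : rho (T a) * rho (T e) * T b =
  ((e == - b)%:R * (kap e * lam a)) *: (T (- a) * S)
  + (B e (- a) b * kap a) *: (S * T (b + e - a))
  + \sum_g \sum_l (B a g l * B e l b) *: (T g * T (g + l + a) * T (l + b + e)).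
Proof.
rewrite -[LHS]mulrA rho_T_T mulrDr -addrA -[X in X + _ = _]scalerAr rho_T_S.
rewrite scalerA [b == _]eq_sym eqr_oppLR -[X in X *: _ + _ = _]mulrA.
congr (_ + _); rewrite mulr_sumr.
(* Only [rho (T a) * T l] with [l = - a] has a component along [S]; it gives the single word
   starting with [S]. *)
transitivity (\sum_l (((l == - a)%:R * (B e l b * kap a)) *: (S * T (l + b + e))
    + \sum_g (B a g l * B e l b) *: (T g * T (g + l + a) * T (l + b + e)))).
  apply: eq_bigr => l _; rewrite -scalerAr [rho _ * _]mulrA rho_T_T mulrDl.
  rewrite scalerDr -scalerAl scalerA mulrCA; congr (_ + _).
  rewrite mulr_suml scaler_sumr; apply: eq_bigr => g _.
  by rewrite -scalerAl scalerA; congr (_ *: _); rewrite [LHS]mulrC.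
rewrite big_split /= sum_indic_scale exchange_big; congr (_ *: (_ * T _) + _).
by group_eq [:: a; b; e].
Qed.

(** * Agreement of the square of [rho] with [sigma] on the generators *)

Let sigma := cuntz_sum_hom S T id (fun g => alpha g \o rho).

Lemma sigma_S x : sigma x * S = S * x.
Proof. exact: cuntz_sum_hom_S. Qed.

Lemma sigma_T x g : sigma x * T g = T g * alpha g (rho x).
Proof. exact: (cuntz_sum_hom_T _ (fun g => alpha g \o rho) hST). Qed.

Lemma rho_rho_S : rho (rho S) = sigma S.
Proof.
apply: (cuntz_ext hST) => [|m].
  (* The words [T a * T a * S] cancel by [sum_Acoef_opp], and [S * S] gets coefficient 1 by
     [dimd_partition]. *)
  rewrite sigma_S rho_S (homD hrho) !(homZ hrho) (hom_sum hrho).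
  rewrite mulrDl -!scalerAl rho_S_mul_S mulr_suml.
  have -> : \sum_g rho (T g * T g) * S = (#|G|%:R / s) *: (S * S)
      + (- d^-1) *: \sum_a T a * T a * S.
    transitivity (\sum_g (s^-1 *: (S * S)
        + \sum_a (lam g * B g a (- g)) *: (T a * T a * S))).
      apply: eq_bigr => g _; rewrite (homM hrho) rho_T_rho_T_S eqxx mul1r.
      by congr (_ + _); apply: eq_bigr => a _; rewrite addrNK [lam g * _]mulrC.
    rewrite big_split /= sumr_const mulr_natl -scalerMnl; congr (_ + _).
    rewrite exchange_big scaler_sumr; apply: eq_bigr => a _ /=.
    by rewrite -scaler_suml (sum_Acoef_opp hP).
  rewrite !scalerDr !scalerA addrACA -!scalerDl mulrCA sqrt_dimdV2.
  rewrite dimd_partition scale1r mulrN [s^-1 * _]mulrC subrr scale0r addr0.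
  by [].
(* The target is [T m * rho S]. The words [S * T m] cancel by [sum_Acoef_opp_l], and the words
   [T b * T b * T m] against the correction term in [sum_Acoef2]. *)
rewrite sigma_T alpha_rho_S rho_S (homD hrho) !(homZ hrho) (hom_sum hrho).
rewrite mulrDl -!scalerAl rho_S_mul_T mulr_suml.
have -> : \sum_g rho (T g * T g) * T m =
    s^-1 *: (T m * S) + (- (d^-1 / s)) *: (S * T m)
    + (\sum_k T m * (T k * T k) - d^-1 *: \sum_b T b * T b * T m).
  transitivity (\sum_g (((g == - m)%:R * (kap g * lam g)) *: (T (- g) * S)
      + (B g (- g) m * kap g) *: (S * T m)
      + \sum_k \sum_b (B g b (k - g) * B g (k - g) m)
          *: (T b * T (b + k) * T (k + m)))).
    apply: eq_bigr => g _; rewrite (homM hrho) rho_T_rho_T_T.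
    congr (_ + _ *: (_ * T _) + _); first by group_eq [:: g; m].
    rewrite exchange_big (reindex_inj (addIr (- g))) /=; apply: eq_bigr => k _.
    apply: eq_bigr => b _; congr (_ *: (_ * T _ * T _));
      by group_eq [:: g; m; b; k].
  rewrite !big_split /= sum_indic_scale opprK mulrC lam_kap.
  congr (_ + _ + _).
    rewrite -scaler_suml; congr (_ *: _).
    transitivity ((\sum_g (eta g)^* * E g * B g (- g) m) / s).
      by rewrite mulr_suml; apply: eq_bigr => g _; rewrite mulrC mulrAC.
    by rewrite (sum_Acoef_opp_l hP) mulNr.
  rewrite exchange_big /=.
  transitivity (\sum_k \sum_b (((b == m)%:R - (k == 0)%:R / d)
      *: (T b * T (b + k) * T (k + m)))).
    apply: eq_bigr => k _; rewrite exchange_big; apply: eq_bigr => b _ /=.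
    by rewrite -scaler_suml (sum_Acoef2 hP).
  transitivity (\sum_k (T m * (T (k + m) * T (k + m))
      - \sum_b ((k == 0)%:R / d) *: (T b * T (b + k) * T (k + m)))).
    apply: eq_bigr => k _; under eq_bigr do rewrite scalerBl.
    rewrite sumrB; congr (_ - _).
    under eq_bigr do rewrite -[_%:R]mulr1.
    by rewrite sum_indic_scale scale1r -mulrA [m + k]addrC.
  rewrite sumrB; congr (_ - _); first by rewrite [RHS](reindex_inj (addIr m)).
  rewrite exchange_big scaler_sumr; apply: eq_bigr => b _ /=.
  by rewrite sum_indic_scale addr0 add0r.
rewrite !scalerDr !scalerA mulrDr -!scalerAr sqrt_dimdV2.
rewrite mulrN [s^-1 * _]mulrCA sqrt_dimdV2 !scalerN scalerA scaleNr.
rewrite mulr_sumr [s^-1 / d]mulrC.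
set x := (d^-1 / d) *: _; set y := (d^-1 / s) *: _.
by rewrite addrACA [x + _]addrC subrK [y + _]addrC subrK.
Qed.

(** By multiplicativity the left side is [rho (rho (T m) * S)], a multiple of
    [rho (T (- m)) * rho S]. Both sides are then matched word by word. *)
Lemma rho_rho_T_rho_S m : rho (rho (T m)) * rho S = sigma (T m) * rho S.
Proof.
have e1 : \sum_g sigma (T m) * (T g * T g) =
    (eps (- m) m * kap (- m)) *: (T m * S)
    + \sum_g \sum_a (eps (- g) m * B (m - g *+ 2) a g)
        *: (T g * T a * T (a + m - g)).
  transitivity (\sum_g
      (((g == m)%:R * (eps (- g) m * kap (m - g *+ 2))) *: (T g * S)
       + \sum_a (eps (- g) m * B (m - g *+ 2) a g)
           *: (T g * T a * T (a + m - g)))).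
    apply: eq_bigr => g _; rewrite mulrA sigma_T -mulrA alpha_rho_T_T.
    rewrite -scalerAr mulrDr scalerDr -scalerAr scalerA mulrCA.
    congr (_ *: _ + _).
      congr ((nat_of_bool _)%:R * _).
      rewrite -subr_eq0 -[RHS]subr_eq0 -[RHS]oppr_eq0.
      by congr (_ == 0); group_eq [:: g; m].
    rewrite mulr_sumr scaler_sumr; apply: eq_bigr => a _.
    rewrite -scalerAr scalerA [X in _ *: X = _]mulrA.
    congr (_ *: (_ * T _)).
    by group_eq [:: g; m; a].
  rewrite big_split sum_indic_scale; congr ((_ * kap _) *: _ + _).
  by group_eq [:: m].
have e2 : \sum_g rho (T (- m)) * (T g * T g) =
    kap (- m) *: (S * T m)
    + \sum_a \sum_g B (- m) a (g + m - a) *: (T a * T g * T (g + m - a)).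
  transitivity (\sum_g (((g == m)%:R * kap (- m)) *: (S * T g)
      + \sum_a B (- m) a g *: (T a * T (a + g - m) * T g))).
    apply: eq_bigr => g _; rewrite mulrA rho_T_T opprK mulrDl -scalerAl.
    congr (_ + _); rewrite mulr_suml; apply: eq_bigr => a _.
    by rewrite -scalerAl.
  rewrite big_split sum_indic_scale exchange_big; congr (_ + _).
  apply: eq_bigr => a _; rewrite (reindex_inj (addIr (m - a))) /=.
  apply: eq_bigr => g _; rewrite addrA; congr (_ *: (_ * T _ * _)).
  by group_eq [:: a; g; m].
rewrite -(homM hrho) rho_T_S (homZ hrho) (homM hrho) rho_S !mulrDr.
rewrite -!scalerAr sigma_S rho_T_S !mulr_sumr e1 e2 !scalerDr !scalerA opprK.
have -> : lam m * d^-1 * lam (- m) = s^-1 * (eps (- m) m * kap (- m)).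
  have e : lam m * lam (- m) = eps (- m) m * ((eta (- m))^* * E (- m)).
    by rewrite /lam /E; phase hP [:: m].
  by rewrite mulrAC e /kap -sqrt_dimdV2; ring.
have -> : lam m / s * kap (- m) = d^-1.
  have e : lam m * ((eta (- m))^* * E (- m)) = 1.
    by rewrite /lam /E; phase hP [:: m].
  by rewrite -[RHS]mul1r -e /kap -sqrt_dimdV2; ring.
rewrite addrCA; congr (_ + (_ + _)); rewrite mulrC -scalerA; congr (_ *: _).
rewrite scaler_sumr; apply: eq_bigr => g _.
rewrite scaler_sumr; apply: eq_bigr => a _.
by rewrite scalerA (Acoef_cycle hP).
Qed.

Lemma rho_rho_T_mul_rho_T m c : rho (rho (T m)) * rho (T c) =
  ((c == - m)%:R * kap m) *: rho S
  + \sum_a B m a c *: (rho (T a) * rho (T (a + c + m))).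
Proof.
rewrite -(homM hrho) rho_T_T (homD hrho) (homZ hrho) (hom_sum hrho).
by congr (_ + _); apply: eq_bigr => a _; rewrite (homZ hrho) (homM hrho).
Qed.

(** On the [sigma] side a single word occurs, which also comes from the main term of
    [sum_Acoef_lam]. The contribution of [rho S], present for [c = - m], is cancelled by the
    correction term there and by [sum_Acoef_row]. *)
Lemma rho_rho_T_rho_T_S m c :
  rho (rho (T m)) * rho (T c) * S = sigma (T m) * rho (T c) * S.
Proof.
transitivity ((eps c m * lam c * lam (m + c *+ 2))
              *: (T (- c) * (T (- m - c *+ 2) * S))); last first.
  rewrite -[RHS]mulrA rho_T_S -[RHS]scalerAr [sigma _ * _]mulrA sigma_T.
  rewrite alpha_rho_T opprK mulNrn opprK.
  have -> : T (- c) * (eps c m *: rho (T (m + c *+ 2))) * S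
      = (eps c m * lam (m + c *+ 2)) *: (T (- c) * (T (- m - c *+ 2) * S)).
    by rewrite -[LHS]mulrA -scalerAl rho_T_S -!scalerAr scalerA opprD.
  by rewrite scalerA; congr (_ *: _); ring.
pose D : R[i] := (c == - m)%:R.
rewrite rho_rho_T_mul_rho_T mulrDl -scalerAl rho_S_mul_S mulr_suml.
transitivity ((D * kap m) *: (d^-1 *: (S * S) + s^-1 *: \sum_g T g * T g * S)
  + \sum_a ((B m a c * (D / s)) *: (S * S) + \sum_g
     (B m a c * B a g (- (a + c + m)) * lam (a + c + m))
       *: (T g * T (g - c - m) * S))).
  congr (_ + _); apply: eq_bigr => a _.
  rewrite -scalerAl rho_T_rho_T_S scalerDr scalerA; congr (_ + _).
    congr ((_ * ((nat_of_bool _)%:R / _)) *: _).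
    by rewrite -{1}[a]addr0 -addrA (inj_eq (addrI a)) eq_sym addr_eq0.
  rewrite scaler_sumr; apply: eq_bigr => g _.
  rewrite scalerA [_ * (_ * _)]mulrA.
  by congr (_ *: (_ * T _ * _)); group_eq [:: a; c; m; g].
rewrite big_split /= -scaler_suml exchange_big /=.
under [X in _ + (_ + X)]eq_bigr => g _ do
  rewrite -scaler_suml (sum_Acoef_lam hP m c g) scalerBl.
rewrite sumrB sum_indic_scale -/D.
have -> : \sum_a B m a c * (D / s) = - (D * kap m / d).
  rewrite -mulr_suml.
  rewrite /D; case: eqP => [->|_]; last by rewrite !mul0r mulr0 oppr0.
  by rewrite (sum_Acoef_row hP) /kap; ring.
have -> : \sum_g (D * ((eta m)^* * E m / d)) *: (T g * T (g - c - m) * S)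
    = (D * kap m / s) *: \sum_g T g * T g * S.
  rewrite /D; case: eqP => [->|_].
    rewrite scaler_sumr; apply: eq_bigr => g _; rewrite opprK addrK.
    by congr (_ *: _); rewrite /kap -sqrt_dimdV2; ring.
  by rewrite !mul0r scale0r big1 // => g _; rewrite scale0r.
rewrite scalerDr !scalerA scaleNr addrACA subrr add0r addrC subrK.
rewrite -[T _ * _ * S]mulrA.
by congr (_ *: (_ * (T _ * _))); group_eq [:: m; c].
Qed.

Lemma rho_rho_T_rho_T_T m c b :
  rho (rho (T m)) * rho (T c) * T b = sigma (T m) * rho (T c) * T b.
Proof.
(* Both sides are brought to a combination of [S * T m], [T k * S] and the cubic words [W u g]; [D]
   marks the case in which [rho S] contributes. *)
pose D : R[i] := (c == - m)%:R; pose k := b + m + c.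
pose W u g : O := T g * T u * T (u - g + k).
pose x u g := eps (- g) m * B c g b * B (m - g *+ 2) u (g + b + c).
pose y := B m (- k) c * lam (- k) * kap (- b).
transitivity (((b == - c)%:R * kap c) *: (S * T m) + y *: (T k * S)
              + \sum_g \sum_u x u g *: W u g); last first.
  have -> : sigma (T m) * rho (T c) * T b =
      ((b == - c)%:R * kap c) *: (S * T m)
      + \sum_g B c g b *: (T g * alpha g (rho (T m)) * T (g + b + c)).
    rewrite -[LHS]mulrA rho_T_T mulrDr -[X in X + _ = _]scalerAr sigma_S.
    congr (_ + _); rewrite mulr_sumr; apply: eq_bigr => g _.
    by rewrite -scalerAr mulrA sigma_T.
  rewrite -addrA; congr (_ + _).
  transitivity (\sum_g (((g == k)%:R
      * (eps (- g) m * B c g b * kap (m - g *+ 2))) *: (T g * S)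
      + \sum_u x u g *: W u g)).
    rewrite big_split /= sum_indic_scale; congr (_ *: _ + _).
    transitivity (B m (- k) c * (eta k * E (- k)) * ((eta b)^* * E b) / s).
      rewrite /y /kap /lam !mulrA; congr (_ / _).
      by rewrite /B /E /k; phase hP [:: m; c; b].
    rewrite -(Acoef_transpose hP (erefl k)) /kap !mulrA; congr (_ / _).
    by rewrite /B /E /k; phase hP [:: m; c; b].
  apply: eq_bigr => g _; rewrite -[T g * alpha g _ * _]mulrA alpha_rho_T_T.
  have -> : (g + b + c == g *+ 2 - m) = (g == k).
    rewrite -subr_eq0 -[RHS]subr_eq0 -[RHS]oppr_eq0; congr (_ == 0).
    by rewrite /k; group_eq [:: g; b; c; m].
  rewrite -scalerAr mulrDr !scalerDr -scalerAr !scalerA.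
  congr (_ *: _ + _); first by ring.
  rewrite mulr_sumr !scaler_sumr; apply: eq_bigr => u _.
  rewrite -scalerAr !scalerA [X in _ = _ *: X]mulrA; congr (_ *: (_ * T _)).
    by rewrite /x [B c g b * _]mulrC.
  by rewrite /k; group_eq [:: g; b; c; m; u].
rewrite rho_rho_T_mul_rho_T mulrDl -scalerAl rho_S_mul_T mulr_suml.
(* The sums over [a] are collected word by word, to be evaluated by [sum_Acoef_kap] and
   [sum_Acoef3]; their correction terms cancel the contribution of [rho S]. *)
transitivity ((D * kap m)
      *: (d^-1 *: (S * T b) + s^-1 *: \sum_g T g * T g * T b)
  + (y *: (T k * S)
     + (\sum_a B m a c * ((eta a)^* * E a) * B (a + c + m) (- a) b / s)
         *: (S * T k)
     + \sum_g \sum_u (\sum_a B m a c * B a g (u - g - a)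
                         * B (a + c + m) (u - g - a) b) *: W u g)).
  congr (_ + _).
  transitivity (\sum_a (((a == - k)%:R * (B m a c * lam a * kap (a + c + m)))
        *: (T (- a) * S)
    + (B m a c * ((eta a)^* * E a) * B (a + c + m) (- a) b / s) *: (S * T k)
    + \sum_g \sum_u (B m a c * B a g (u - g - a)
                         * B (a + c + m) (u - g - a) b) *: W u g)).
    apply: eq_bigr => a _; rewrite -scalerAl rho_T_rho_T_T !scalerDr !scalerA.
    have -> : (a + c + m == - b) = (a == - k).
      rewrite -subr_eq0 -[RHS]subr_eq0; congr (_ == 0).
      by rewrite /k; group_eq [:: a; b; c; m].
    congr (_ *: _ + _ *: (_ * T _) + _).
    - by ring.
    - by rewrite /kap; ring.
    - by rewrite /k; group_eq [:: a; b; c; m].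
    rewrite scaler_sumr; apply: eq_bigr => g _.
    rewrite scaler_sumr (reindex_inj (addIr (- g - a))); apply: eq_bigr => u _.
    rewrite /= [u + _]addrA scalerA [X in X *: _ = _]mulrA.
    by congr (_ *: (_ * T _ * T _)); rewrite /k; group_eq [:: a; b; c; m; g; u].
  rewrite !big_split /= sum_indic_scale -scaler_suml opprK.
  congr (_ *: _ + _ + _).
    by congr (_ * kap _); rewrite /k; group_eq [:: m; c; b].
  rewrite exchange_big; apply: eq_bigr => g _ /=.
  by rewrite exchange_big; apply: eq_bigr => u _ /=; rewrite scaler_suml.
have -> : \sum_a B m a c * ((eta a)^* * E a) * B (a + c + m) (- a) b / s
    = (b == - c)%:R * kap c - D * kap m / d.
  by rewrite -mulr_suml (sum_Acoef_kap hP) /kap /D; ring.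
have -> : \sum_g \sum_u (\sum_a B m a c * B a g (u - g - a)
      * B (a + c + m) (u - g - a) b) *: W u g
    = \sum_g \sum_u x u g *: W u g - (D * kap m / s) *: \sum_g T g * T g * T b.
  rewrite scaler_sumr -sumrB; apply: eq_bigr => g _.
  under eq_bigr => u _ do
    rewrite (sum_Acoef3 hP) scalerBl -/D -[D * _ * _]mulrA [D * _]mulrCA.
  rewrite sumrB sum_indic_scale; congr (_ - _).
  rewrite /D; case: eqP => [cm|_]; last by rewrite !mul0r !scale0r.
  rewrite /W /k cm subrr add0r addrK; congr (_ *: _).
  by rewrite /kap -sqrt_dimdV2; ring.
(* The index [k] is [m] when [b = - c] and is [b] when [c = - m], and the scalars vanish
   otherwise. *)
have f1 : ((b == - c)%:R * kap c) *: (S * T k)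
    = ((b == - c)%:R * kap c) *: (S * T m).
  case: eqP => [bc|_]; last by rewrite !mul0r !scale0r.
  by congr (_ *: (_ * T _)); rewrite /k bc; group_eq [:: c; m].
have f2 : (D * kap m / d) *: (S * T k) = (D * kap m / d) *: (S * T b).
  rewrite /D; case: eqP => [cm|_]; last by rewrite !mul0r !scale0r.
  by congr (_ *: (_ * T _)); rewrite /k cm addrK.
rewrite scalerBl f1 f2 scalerDr !scalerA.
set p := (D * kap m / d) *: _; set q := (D * kap m / s) *: _.
rewrite addrACA [q + _]addrC subrK [p + _]addrC [y *: _ + (_ - p)]addrA subrK.
by rewrite [y *: _ + _]addrC.
Qed.

Lemma rho_rho_T m : rho (rho (T m)) = sigma (T m).
Proof.
apply: (cuntz_ext (cuntz_family_hom hST hrho)) => [|c].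
  exact: rho_rho_T_rho_S.
apply: (cuntz_ext hST) => [|b].
  exact: rho_rho_T_rho_T_S.
exact: rho_rho_T_rho_T_T.
Qed.

End Endomorphism.

Theorem theorem4p1 (R : realType) (G : finZmodType)
  (eps : G -> G -> R[i]) (eta : G -> R[i]) (A : G -> G -> G -> R[i])
  (hP : polynomial_equations eps eta A)
  (O : cstarAlgType R) (S : O) (T : G -> O) (hO : cuntz_algebra S T)
  (alpha : G -> O -> O) (halpha : star_action alpha)
  (halphaE : alpha_formulas eps S T alpha)
  (rho : O -> O) (hrho : unital_star_hom rho)
  (hrhoE : rho_formulas eta A S T alpha rho) :
  intertwiner id (rho \o rho) S /\
  forall g : G, intertwiner (alpha g \o rho) (rho \o rho) (T g).
Proof.
have [hST _] := hO.
pose sigma := cuntz_sum_hom S T id (fun g => alpha g \o rho).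
have hid : unital_star_hom (@id O) by [].
have hcomp (f : O -> O) : unital_star_hom f -> unital_star_hom (f \o rho).
  move=> hf; split=> [a x y|| x] /=.
  - by rewrite (homD hrho) (homZ hrho) (homD hf) (homZ hf).
  - split=> [|x y] /=; first by rewrite (hom1 hrho) (hom1 hf).
    by rewrite (homM hrho) (homM hf).
  - by rewrite (hom_star hrho) (hom_star hf).
have hal g : unital_star_hom (alpha g) by case: halpha.
have e x : rho (rho x) = sigma x.
  apply: (cuntz_hom_ext hO (hcomp _ hrho)).
  - by apply: (cuntz_sum_hom_star_hom hST hid) => g; apply: hcomp.
  - exact: (rho_rho_S hP hST halpha halphaE hrho hrhoE).
  - exact: (rho_rho_T hP hST halpha halphaE hrho hrhoE).
split=> [x|g x] /=; rewrite e.
  by rewrite (cuntz_sum_hom_S _ _ hST).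
by rewrite (cuntz_sum_hom_T _ _ hST).
Qed.
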